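(* Let $(X,d)$ be a locally connected metric space and $f:X\to X$ a continuous map. Then $(X,f)$ is cofinitely sensitive if and only if it is cofinitely strongly $\beta$-$n$-sensitive, i.e. if and only if it is cofinitely $\beta$-$n$-sensitive for every $n\in\mathbb{N}$ with $n\ge2$ and every $\beta\in\mathbb{N}^n$.
   Context: $\mathbb{N}=\{1,2,3,\dots\}$. A set $A\subseteq\mathbb{N}$ is cofinite if there is $N\in\mathbb{N}$ with $A\supseteq[N,\infty)\cap\mathbb{N}$. - $(X,f)$ is cofinitely sensitive if there is $\delta>0$ such that for every nonempty open $U\subseteq X$ the set $\{k\in\mathbb{N}:\exists x,y\in U \text{ with } d(f^k(x),f^k(y))>\delta\}$ is cofinite. - For $n\ge 2$ and $\beta=(m_1,\dots,m_n)\in\mathbb{N}^n$, $(X,f)$ is cofinitely $\beta$-$n$-sensitive if there is $\delta>0$ (allowed to depend on $n$ and $\beta$) such that for every nonempty open $U\subseteq X$ the set $\{k\in\mathbb{N}:\exists x_1,\dots,x_n\in U \text{ with } \min_{1\leq i<j\leq n}d(f^{m_ik}(x_i),f^{m_jk}(x_j))>\delta\}$ is cofinite. *)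

(* Defs.v *)
From HB Require Import structures.
From mathcomp Require Import all_boot all_order all_algebra.
From mathcomp Require Import all_classical all_reals topology.
Set Implicit Arguments.
Unset Strict Implicit.
Unset Printing Implicit Defensive.
Import Order.TTheory GRing.Theory Num.Theory.
Local Open Scope classical_set_scope.
Local Open Scope ring_scope.

Definition locally_connected (X : topologicalType) : Prop :=
  forall (x : X) (U : set X), open U -> U x ->
    exists V : set X, [/\ open V, connected V, V x & V `<=` U].

(* The natural numbers of the theory are the positive ones, hence the
   conditions [0 < _] on nat here and below. *)
Definition cofinite (A : set nat) : Prop :=
  exists2 N : nat, (0 < N)%N & forall k : nat, (N <= k)%N -> A k.

Definition cofinitely_sensitive (R : realType) (X : metricType R)
    (f : X -> X) : Prop :=
  exists2 delta : R, 0 < delta &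
    forall U : set X, open U -> U !=set0 ->
      cofinite [set k : nat | (0 < k)%N /\
        exists x y : X, [/\ U x, U y &
          delta < mdist (iter k f x) (iter k f y)]].

(* As the set of pairs i < j is finite, and nonempty when n >= 2, the minimum
   of the pairwise distances exceeds delta iff each of them does. *)
Definition cofinitely_beta_sensitive (R : realType) (X : metricType R)
    (f : X -> X) (n : nat) (beta : 'I_n -> nat) : Prop :=
  exists2 delta : R, 0 < delta &
    forall U : set X, open U -> U !=set0 ->
      cofinite [set k : nat | (0 < k)%N /\
        exists x : 'I_n -> X, (forall i, U (x i)) /\
          forall i j : 'I_n, (i < j)%N ->
            delta < mdist (iter (beta i * k) f (x i))
                          (iter (beta j * k) f (x j))].

Definition cofinitely_strongly_sensitive (R : realType) (X : metricType R)
    (f : X -> X) : Prop :=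
  forall (n : nat) (beta : 'I_n -> nat), (2 <= n)%N ->
    (forall i, (0 < beta i)%N) -> cofinitely_beta_sensitive f beta.

(* Main.v *)
Require Import Defs.
From mathcomp Require Import all_boot all_order all_algebra.
From mathcomp Require Import all_classical all_reals topology.
From mathcomp Require Import normedtype lra.

(** A connected set [V] on which [f^k] separates two points by more than
    [delta] has a connected image under [f^k], so the distance to one of these
    points takes every value in [0, delta] on that image.  Hence the image
    contains [n] points whose mutual distances are at least [delta / n], and
    fewer than [n] balls of radius [delta / 3n] cannot cover them.  By local
    connectedness, this applies to connected open subsets of any open set at
    all the times [m_i k], and the points [x_i] are chosen greedily. *)

Set Implicit Arguments.
Unset Strict Implicit.
Unset Printing Implicit Defensive.
Import Order.TTheory GRing.Theory Num.Theory.
Import numFieldNormedType.Exports.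
Local Open Scope classical_set_scope.
Local Open Scope ring_scope.

Lemma continuous_iter (T : topologicalType) (f : T -> T) (k : nat) :
  continuous f -> continuous (iter k f).
Proof.
move=> cf; elim: k => [|k IHk] x; first exact: cvg_id.
exact: (@continuous_comp _ _ _ (iter k f) f x (IHk x) (cf _)).
Qed.

Lemma mdist_continuous (R : realType) (X : metricType R) (a : X) :
  continuous (mdist a : X -> R).
Proof.
move=> x; apply/cvgrPdist_lt => e e0; near=> y.
have xy : mdist x y < e.
  by near: y; have := nbhsx_ballx x e e0; rewrite ballEmdist.
have := metric_triangle a x y; have := metric_triangle a y x.
rewrite (metric_sym y x) ltr_norml => ? ?; apply/andP; split; lra.
Unshelve. all: by end_near. Qed.

Lemma connected_mdist_surj (R : realType) (X : metricType R) (C : set X)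
    (a b : X) (t : R) :
  connected C -> C a -> C b -> 0 <= t <= mdist a b ->
  exists2 z, C z & mdist a z = t.
Proof.
move=> cC Ca Cb tab.
have /connected_intervalP ivl : connected (mdist a @` C).
  apply: connected_continuous_connected cC _.
  exact/continuous_subspaceT/mdist_continuous.
have [||z Cz <-] := ivl 0 (mdist a b) _ _ t tab; last by exists z.
- by exists a => //; exact: mdistxx.
- by exists b.
Qed.

(** Pigeonhole: the grid points [j * 3e] are at least [3e] apart, so each [q i] lies within [e] of
    at most one of them, and there are fewer [q i] than grid points. *)
Lemma grid_point_far (R : realFieldType) (m n : nat) (q : 'I_m -> R) (e : R) :
  (m < n)%N -> 0 < e ->
  exists j : 'I_n, forall i, e < `|j%:R * (3 * e) - q i|.
Proof.
move=> mn e0; apply: contrapT => noj.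
have close j : exists i, `|(j : 'I_n)%:R * (3 * e) - q i| <= e.
  apply: contrapT => noi; apply: noj; exists j => i.
  by rewrite ltNge; apply/negP => le; apply: noi; exists i.
have [g gP] := choice close.
have g_lt (j j' : 'I_n) : (j < j')%N -> g j <> g j'.
  move=> jj' gjj'; have := gP j; have := gP j'; rewrite gjj' !ler_norml.
  (* Two grid points within [e] of the same [q i] would be at most [2e] apart. *)
  have : (j%:R + 1) * (3 * e) <= j'%:R * (3 * e).
    by rewrite ler_wpM2r ?natr1 ?ler_nat //; lra.
  move=> ? /andP[_ ?] /andP[? _]; lra.
suff /leq_card : injective g by rewrite !card_ord leqNgt mn.
move=> j j' gjj'; apply: val_inj.
by case: (ltngtP j j') => // /g_lt; rewrite gjj'.
Qed.

(** The map [mdist a] is 1-Lipschitz, so it suffices that [mdist a z] is a grid value far from every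
    [mdist a (p i)]. The points [p i] may lie outside [C]. *)
Lemma connected_point_far (R : realType) (X : metricType R) (C : set X)
    (a b : X) (delta : R) (m n : nat) (p : 'I_m -> X) :
  connected C -> C a -> C b -> 0 < delta < mdist a b -> (m < n)%N ->
  exists2 z, C z & forall i, delta / (3 * n%:R) < mdist (p i) z.
Proof.
move=> cC Ca Cb /andP[delta0 ab] mn.
have n0 : 0 < n%:R :> R by rewrite ltr0n (leq_ltn_trans _ mn).
set e := delta / _; have e0 : 0 < e by rewrite divr_gt0// mulr_gt0.
(* Hence all grid values [j * 3e] with [j < n] lie in [[0, delta]], where [mdist a] attains them on
   [C]. *)
have deltaE : delta = n%:R * (3 * e).
  by rewrite mulrA [RHS]mulrC [n%:R * 3]mulrC divfK// gt_eqF// mulr_gt0.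
have [j jP] := grid_point_far (fun i => mdist a (p i)) mn e0.
have [|z Cz az] := @connected_mdist_surj _ _ C a b (j%:R * (3 * e)) cC Ca Cb.
  have e3 : 0 <= 3 * e by rewrite mulr_ge0// ltW.
  apply/andP; split; first by rewrite mulr_ge0.
  by rewrite (le_trans _ (ltW ab))// deltaE ler_wpM2r// ler_nat ltnW.
exists z => // i; apply: lt_le_trans (jP i) _; rewrite -az ler_norml.
have := metric_triangle a (p i) z; have := metric_triangle a z (p i).
rewrite (metric_sym z) => ? ?; apply/andP; split; lra.
Qed.

Lemma connected_separated_choice (R : realType) (X : metricType R) (n : nat)
    (C : 'I_n -> set X) (delta : R) :
  0 < delta -> (forall i, connected (C i)) ->
  (forall i, exists a b, [/\ C i a, C i b & delta < mdist a b]) ->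
  exists x : 'I_n -> X, (forall i, C i (x i)) /\
    forall i j : 'I_n, (i < j)%N -> delta / (3 * n%:R) < mdist (x i) (x j).
Proof.
move=> delta0 cC Cdelta.
(* Greedy induction: only the first [l] points are separated so far, the others being arbitrary
   points of their sets [C i]. The bound involves [n], not [l], so it does not degrade. *)
suff /(_ n (leqnn n)) [x [Cx xP]] : forall l, (l <= n)%N ->
    exists x : 'I_n -> X, (forall i, C i (x i)) /\
    forall i j : 'I_n, (i < j < l)%N -> delta / (3 * n%:R) < mdist (x i) (x j).
  by exists x; split=> // i j ij; apply: xP; rewrite ij ltn_ord.
elim=> [_|l IHl ln].
  have /choice[x Cx] : forall i, exists a, C i a.
    by move=> i; have [a [_ [Ca _ _]]] := Cdelta i; exists a.
  by exists x; split=> // i j; rewrite ltn0 andbF.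
have [x [Cx xP]] := IHl (ltnW ln).
pose o : 'I_n := Ordinal ln.
have [a [b [Ca Cb ab]]] := Cdelta o.
have delta_ab : 0 < delta < mdist a b by rewrite delta0.
have [z Cz zP] := connected_point_far
  (fun i : 'I_l => x (widen_ord (ltnW ln) i)) (cC o) Ca Cb delta_ab ln.
exists (fun i => if i == o then z else x i); split=> [i|i j /andP[ij]].
  by case: eqP => [->|_].
rewrite ltnS leq_eqVlt => jl.
(* Since [i < j <= l], only [j] can be the index whose point was replaced by [z]. *)
have /negPf -> : i != o.
  rewrite -val_eqE /= neq_ltn; case/orP: jl => [/eqP <-|jl]; first by rewrite ij.
  by rewrite (ltn_trans ij jl).
rewrite -val_eqE /=; case: eqP jl => [jl _|_ /= jl]; last first.
  by apply: xP; rewrite ij.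
rewrite jl in ij; have := zP (Ordinal ij).
by congr (_ < mdist (x _) _); exact: val_inj.
Qed.

Theorem theorem7 (R : realType) (X : metricType R) (f : X -> X)
    (hX : locally_connected X) (hf : continuous f) :
  cofinitely_sensitive f <-> cofinitely_strongly_sensitive f.
Proof.
split=> [[delta delta0 sens] n beta n2 beta0|strong]; last first.
  (* Plain sensitivity is the case [n = 2], [beta = (1, 1)]. *)
  have [delta delta0 sens] := strong 2%N (fun=> 1%N) isT (fun=> isT).
  exists delta => // U oU U0; have [N N0 NP] := sens U oU U0.
  exists N => // k /NP[k0 [x [Ux xP]]]; split=> //.
  exists (x ord0), (x ord_max); split=> //.
  by have := xP ord0 ord_max isT; rewrite mul1n.
exists (delta / (3 * n%:R)).
  by rewrite divr_gt0// mulr_gt0// ltr0n (leq_trans _ n2).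
move=> U oU [u Uu]; have [V [oV cV Vu VU]] := hX u U oU Uu.
have [|N N0 NP] := sens V oV; first by exists u.
exists N => // k Nk; split; first exact: leq_trans N0 Nk.
have [|i|y [Vy yP]] := @connected_separated_choice R X n
    (fun i => iter (beta i * k) f @` V) delta delta0.
- move=> i; apply: connected_continuous_connected cV _.
  exact/continuous_subspaceT/continuous_iter.
(* The threshold [N] for [V] serves all [i] at once, because [beta i * k >= k >= N]. *)
- have [|_ [x [y [Vx Vy xy]]]] := NP (beta i * k)%N.
    by rewrite (leq_trans Nk)// leq_pmull.
  by exists (iter (beta i * k) f x), (iter (beta i * k) f y); split.
have /choice[x xP] : forall i, exists v, V v /\ iter (beta i * k) f v = y i.
  by move=> i; have [v Vv vy] := Vy i; exists v.
exists x; split=> [i|i j ij]; first by apply: VU; exact: (xP i).1.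
by rewrite (xP i).2 (xP j).2; exact: yP.
Qed.
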